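(* Let $P$ be a probability measure with finite support and let $M\subset\Delta_P$ be such that there exists $h_0\in M$ with $h_0>0$. Then $M\cdot M^\circ$ is dense in $\Delta_P$ if and only if $\overline{M}=M^{\circ\circ}$.
   Context: For a probability measure $P$: $\Delta_P=\{h\in L^1(P):h\ge 0,\ \langle h,1\rangle=1\}$, where $\langle h,g\rangle=\int hg\,dP$; $L^1(P)_+$ is the set of $f\in L^1(P)$ with $f\ge 0$; $h_0>0$ means strictly positive $P$-almost everywhere. For a subset $M\subset\Delta_P$, $$M^\circ=\{g\in L^1(P)_+:\ \langle h,g\rangle=1\ \text{for all } h\in M\},\qquad M^{\circ\circ}=\{h\in L^1(P)_+:\ \langle h,g\rangle=1\ \text{for all } g\in M^\circ\},$$ $M\cdot M^\circ=\{hg:h\in M,\ g\in M^\circ\}$ (pointwise products; a subset of $\Delta_P$), and $\overline{M}$ is the closure of $M$ in $L^1(P)$. Density is with respect to the $L^1(P)$-norm. *)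

(* Defs.v *)
From HB Require Import structures.
From mathcomp Require Import all_boot all_order all_algebra.
From mathcomp Require Import all_classical all_reals all_analysis.

Set Implicit Arguments.
Unset Strict Implicit.
Unset Printing Implicit Defensive.

Import Order.TTheory GRing.Theory Num.Theory.
Import numFieldNormedType.Exports.

Local Open Scope classical_set_scope.
Local Open Scope ring_scope.

Section L1.
Context (d : measure_display) (T : measurableType d) (R : realType).
Variable P : probability T R.

(* P is carried by a finite set of points. For a measurable F the condition
   says P F = 1; stated this way, it does not require that points be
   measurable. *)
Definition finitely_supported : Prop :=
  exists2 F : set T, finite_set F &
    forall A, measurable A -> A `&` F = set0 -> P A = 0%E.

(* The elements are classes modulo almost-everywhere equality, so Leibniz
   equality is equality in L^1(P). *)
Definition L1 : Type := LspaceType1 P.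

(* A representative of the class. Every notion below is invariant under
   almost-everywhere equality, hence independent of its choice. *)
Definition L1_fun (f : L1) : T -> R := f.
Coercion L1_fun : L1 >-> Funclass.

(* Extended-real valued, since the product of two elements of L^1(P) need not
   be integrable. *)
Definition pairing (f g : T -> R) : \bar R := (\int[P]_x (f x * g x)%:E)%E.

Definition L1_nneg : set L1 := [set f : L1 | {ae P, forall x, 0 <= f x}].

Definition Delta : set L1 :=
  [set h : L1 | L1_nneg h /\ pairing h (cst 1) = 1%E].

(* As the pairing is symmetric, [polar M] is M° and [polar (polar M)] is
   M°°. *)
Definition polar (M : set L1) : set L1 :=
  [set g : L1 | L1_nneg g /\ forall h, M h -> pairing h g = 1%E].

Definition pointwise_products (A B : set L1) : set L1 :=
  [set u : L1 | exists h g,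
    [/\ A h, B g & {ae P, forall x, u x = h x * g x}]].

Definition L1_closure (A : set L1) : set L1 :=
  [set f : L1 | forall e : R, 0 < e ->
    exists2 g, A g & ('N[P]_1[(fun x => (f x - g x)%:E)] < e%:E)%E].

Definition L1_dense_in (A B : set L1) : Prop := B `<=` L1_closure A.

End L1.

Arguments L1_nneg [d T R] P.
Arguments Delta [d T R] P.

(* Main.v *)
Require Import Defs.
From HB Require Import structures.
From mathcomp Require Import all_boot all_order all_algebra.
From mathcomp Require Import all_classical all_reals all_analysis.
From mathcomp Require Import measurable_realfun generic_quotient ring lra.

Set Implicit Arguments.
Unset Strict Implicit.
Unset Printing Implicit Defensive.

Import Order.TTheory GRing.Theory Num.Theory.
Import numFieldNormedType.Exports.

Local Open Scope classical_set_scope.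
Local Open Scope ring_scope.

(** A finitely supported [P] sees only finitely many points, each isolated from
the others by a measurable set of positive measure.  Evaluating at those points
turns L^1(P) into the functions on a finite index set, with positive weights
[w], integration into the weighted sum, and almost-everywhere statements into
statements about the points.  The theorem is then finite-dimensional.

If the products of M and M° are dense and [h] lies in M°° with [h > 0], then [h] itself lies in
Delta, so some product [h' g] with [h'] in M and [g] in M° is close to [h].
The bipolar relation says that [h], [h'] and [h g] have the same integral 1.
Taking [h' g = h] for simplicity, one has [h g = h^2 / h'] and the integral of
[(h' - h)^2 / h' = h' - 2 h + h g] vanishes, whence [h' = h]: a positive density
factors in only one way.  Lemma [factor_near_density] is the quantitative
version of this computation, and shows that [h'] is close to [h].  A general [h]
in M°° is first mixed with the positive element of M.

Conversely, a positive density [u] factors as [h g] with [h] in M°° and [g] in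
M° (lemma [density_factorisation]).  Here [h] maximises the integral of
[u ln h] over M°°.  As [h > 0] and M°° is cut out of the positive orthant by
affine equations, one may move from [h] in both directions along M°°; the
derivative vanishes, which says that [u / h] has integral 1 against every
element of M°°, that is, [u / h] lies in M°.  If M is dense in M°°, replacing
[h] by a nearby element of M gives a product of M and M° near [u], and the positive
densities are dense in Delta. *)

(** * Weighted sums over a finite index set *)

Lemma exists_common_lower_bound (R : realType) n (v : 'I_n -> R) :
  (forall i, 0 < v i) -> exists2 m, 0 < m & forall i, m <= v i.
Proof.
move=> v0; exists (\big[Num.min/1]_i v i); last by move=> i; exact: bigmin_le_cond.
by rewrite lt_bigmin// => i _.
Qed.

Lemma ler_term_sum (R : realType) n (v : 'I_n -> R) i :
  (forall j, 0 <= v j) -> v i <= \sum_j v j.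
Proof. by move=> v0; rewrite (bigD1 i)//= lerDl sumr_ge0. Qed.

Section WeightedSums.
Context (R : realType) (n : nat) (w : 'I_n -> R).
Hypothesis w0 : forall i, 0 < w i.
Implicit Types a b c g h : 'I_n -> R.

Definition wdist a b : R := \sum_i w i * `|a i - b i|.

Lemma wdist_triangle b a c : wdist a c <= wdist a b + wdist b c.
Proof.
rewrite /wdist -big_split/=; apply: ler_sum => i _.
by rewrite -mulrDr ler_pM2l// ler_distD.
Qed.

Lemma wdist_sym a b : wdist a b = wdist b a.
Proof. by apply: eq_bigr => i _; rewrite distrC. Qed.

Lemma wdist_mix a b t : (forall i, 0 <= a i) -> (forall i, 0 <= b i) ->
  \sum_i w i * a i = 1 -> \sum_i w i * b i = 1 -> 0 <= t ->
  wdist a (fun i => (1 - t) * a i + t * b i) <= 2 * t.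
Proof.
move=> a0 b0 a1 b1 t0.
rewrite (_ : 2 * t = \sum_i (t * (w i * a i) + t * (w i * b i))); last first.
  by rewrite big_split/= -!mulr_sumr a1 b1; ring.
apply: ler_sum => i _.
have -> : a i - ((1 - t) * a i + t * b i) = t * (a i - b i) by ring.
rewrite normrM (ger0_norm t0) mulrCA -mulrDr; apply: ler_wpM2l => //.
by rewrite -mulrDr ler_pM2l// (le_trans (ler_normB _ _))// !ger0_norm.
Qed.

Lemma wdist_mul a b c : (forall i, 0 <= c i) ->
  wdist (fun i => a i * c i) (fun i => b i * c i) <= (\sum_i c i + 1) * wdist a b.
Proof.
move=> c0; rewrite /wdist mulr_sumr; apply: ler_sum => i _.
rewrite -mulrBl normrM (ger0_norm (c0 i)).
have -> : w i * (`|a i - b i| * c i) = c i * (w i * `|a i - b i|) by ring.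
apply: ler_wpM2r.
  by rewrite mulr_ge0// ltW.
by rewrite (le_trans (ler_term_sum i c0))// lerDl.
Qed.

Lemma ler_dist_wdist a b : `|\sum_i w i * a i - \sum_i w i * b i| <= wdist a b.
Proof.
rewrite -sumrB (le_trans (ler_norm_sum _ _ _))//; apply: ler_sum => i _.
by rewrite -mulrBr normrM (gtr0_norm (w0 i)).
Qed.

Lemma ler_wdist_coord a b i : w i * `|a i - b i| <= wdist a b.
Proof.
apply: (ler_term_sum i (v := fun i => w i * `|a i - b i|)) => j.
by rewrite mulr_ge0// ltW.
Qed.

(** Let [D = s^2 / 2], which bounds the relative error of [h' g] against [h].  Then
[h^2 / h' <= h g / (1 - D)], so the weighted sum of [(h' - h)^2 / h'], that is,
of [h' - 2 h + h^2 / h'], is at most [1 - 2 + 1 / (1 - D) <= 2 D = s^2].  The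
distance follows from [2 |h' - h| <= s h' + (h' - h)^2 / (s h')]. *)
Lemma factor_near_density h h' g s :
  (forall i, 0 < h i) -> (forall i, 0 <= h' i) -> (forall i, 0 <= g i) ->
  \sum_i w i * h i = 1 -> \sum_i w i * h' i = 1 -> \sum_i w i * (h i * g i) = 1 ->
  0 < s -> s <= 1 ->
  (forall i, `|h' i * g i - h i| <= s ^+ 2 / 2 * h i) ->
  wdist h' h <= s.
Proof.
move=> h0 h'0 g0 hE h'E hgE s0 s1 close.
set dl := s ^+ 2 / 2 in close.
have dl0 : 0 < dl by rewrite divr_gt0// exprn_gt0.
have dl1 : dl <= 2^-1 by rewrite /dl; nra.
have h'gt0 i : 0 < h' i.
  rewrite lt_def h'0 andbT; apply/eqP => h'i0.
  have := close i; rewrite h'i0 mul0r sub0r normrN gtr0_norm//.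
  by have := h0 i; nra.
pose ub i := (s * h' i + (h' i - 2 * h i + (1 - dl)^-1 * (h i * g i)) / s) / 2.
have termP i : `|h' i - h i| <= ub i.
  have hg : h i ^+ 2 / h' i <= (1 - dl)^-1 * (h i * g i).
    have d1 : 0 < 1 - dl by lra.
    rewrite ler_pdivrMr// -mulrA mulrC ler_pdivlMr//.
    have := close i; rewrite ler_distl => /andP[+ _].
    have := h0 i; nra.
  have q0 : (h' i - h i) ^+ 2 / h' i = h' i - 2 * h i + h i ^+ 2 / h' i.
    by field; rewrite gt_eqF.
  have {hg q0} q : (h' i - h i) ^+ 2 / h' i <=
      h' i - 2 * h i + (1 - dl)^-1 * (h i * g i) by rewrite q0 lerD2l.
  apply: (@le_trans _ _ ((s * h' i + (h' i - h i) ^+ 2 / h' i / s) / 2)).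
    (* after multiplication by s h': 2ab <= a^2 + b^2 with a = s h', b = |h' - h| *)
    rewrite ler_pdivlMr// -(ler_pM2r (_ : 0 < s * h' i)) ?mulr_gt0//.
    rewrite (_ : (s * h' i + (h' i - h i) ^+ 2 / h' i / s) * (s * h' i) =
      (s * h' i) ^+ 2 + `|h' i - h i| ^+ 2); last first.
      by rewrite real_normK ?num_real//; field; rewrite !gt_eqF.
    by have := sqr_ge0 (s * h' i - `|h' i - h i|); rewrite sqrrB; lra.
  by rewrite ler_pM2r ?invr_gt0// lerD2l ler_pM2r ?invr_gt0.
apply: (@le_trans _ _ (\sum_i w i * ub i)).
  by apply: ler_sum => i _; rewrite ler_pM2l.
rewrite (_ : \sum_i w i * ub i = (s + (1 - 2 + (1 - dl)^-1) / s) / 2); last first.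
  transitivity (\sum_i ((s + s^-1) / 2 * (w i * h' i) - s^-1 * (w i * h i) +
    (1 - dl)^-1 / s / 2 * (w i * (h i * g i)))).
    apply: eq_bigr => i _; rewrite /ub; field; rewrite gt_eqF//=; lra.
  rewrite big_split/= sumrB -!mulr_sumr hE h'E hgE; field.
  by rewrite gt_eqF//=; lra.
have : (1 - 2 + (1 - dl)^-1) / s <= s.
  rewrite ler_pdivrMr// (_ : s * s = 2 * dl); last by rewrite /dl; field.
  suff : (1 - dl)^-1 <= 1 + 2 * dl by lra.
  by rewrite -[X in X <= _]mul1r ler_pdivrMr; nra.
lra.
Qed.

End WeightedSums.

(** * Factoring a positive density by maximising a weighted logarithm *)

Section Factorisation.
Context (R : realType) (n : nat).
Implicit Types (w h g u k : 'I_n -> R).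

(** The polar of [G] for the pairing with weights [w]: the values at the atoms of
the elements of a polar in L^1(P). *)
Definition weighted_polar w (G : set ('I_n -> R)) : set ('I_n -> R) :=
  [set h | (forall i, 0 <= h i) /\ forall g, G g -> \sum_i w i * (h i * g i) = 1].

Lemma is_derive_weighted_log (a p v : 'I_n -> R) (t : R) :
  (forall i, 0 < p i + t * v i) ->
  is_derive t 1 (fun t => \sum_i a i * ln (p i + t * v i))
    (\sum_i a i * (v i / (p i + t * v i))).
Proof.
move=> pos.
have -> : (fun t => \sum_i a i * ln (p i + t * v i)) =
    \sum_i (fun t : R => a i * ln (p i + t * v i)).
  by apply/funext => x; rewrite fct_sumE.
apply: is_derive_sum => i.
have lin : is_derive t 1 (fun t : R => p i + t * v i) (v i).
  have := is_deriveD (is_derive_cst (p i) t 1)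
    (is_deriveM (is_derive_id t (1 : R)) (is_derive_cst (v i) t 1)).
  move=> H; apply: (is_derive_eq H).
  by rewrite scaler0 !add0r /GRing.scale/= mulr1.
have lnp := is_derive1_ln (pos i).
have := @is_derive1_comp _ _ (fun t : R => p i + t * v i) t _ _ lnp lin.
move=> /(is_deriveZ (a i)) H; apply: (is_derive_eq H).
by rewrite /GRing.scale/= [v i * _]mulrC.
Qed.

(** Since [t] may have either sign, the derivative of the weighted logarithm at the
maximum [p] in the direction [k - p] is zero, and not only nonpositive; that
derivative is the difference of the two sides. *)
Lemma max_weighted_log_first_order (w u p k : 'I_n -> R) (e : R) :
  (forall i, 0 < p i) -> 0 < e ->
  (forall t : R, `|t| < e -> (forall i, 0 < p i + t * (k i - p i)) /\
   \sum_i (w i * u i) * ln (p i + t * (k i - p i)) <=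
   \sum_i (w i * u i) * ln (p i)) ->
  \sum_i w i * (k i * (u i / p i)) = \sum_i w i * u i.
Proof.
move=> p0 e0 H.
have inE' (t : R) : t \in `]-e, e[%R -> `|t| < e by rewrite in_itv/= ltr_norml.
pose f t : R := \sum_i (w i * u i) * ln (p i + t * (k i - p i)).
have fd (t : R) : t \in `]-e, e[%R -> is_derive t 1 f
    (\sum_i (w i * u i) * ((k i - p i) / (p i + t * (k i - p i)))).
  by move=> /inE'/H[pos _]; exact: is_derive_weighted_log.
have in0 : (0 : R) \in `]-e, e[%R by rewrite in_itv/= oppr_lt0 e0.
have d0 : is_derive (0 : R) (1 : R) f (0 : R).
  apply: (@derive1_at_max _ _ (-e) e) => //.
  - by lra.
  - by move=> t /fd [].
  - move=> t /inE'/H[_ /le_trans]; apply; rewrite /f.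
    by under [leRHS]eq_bigr do rewrite mul0r addr0.
have [_ +] := fd _ in0; have [_ ->] := d0 => /esym/eqP.
rewrite (_ : \sum_i _ = \sum_i w i * (k i * (u i / p i)) - \sum_i w i * u i).
  by rewrite subr_eq0 => /eqP.
rewrite -sumrB; apply: eq_bigr => i _; field.
by rewrite ?mul0r ?addr0 gt_eqF.
Qed.


(** The logarithm is not continuous where a coordinate vanishes, so compactness is
used on the elements of the polar with all coordinates at least [c].  Nothing is
lost: where the weighted logarithm reaches its value at [h0], every coordinate
is bounded below by an explicit positive constant, because the remaining terms
are bounded above by [w_j u_j ln h_j <= w_j u_j h_j <= u_j].  Taking [c] strictly
below these constants leaves room around the maximum [p], which lies strictly
inside the truncated set. *)
Lemma maximal_weighted_log_density w (G : set ('I_n -> R)) h0 u :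
  (forall i, 0 < w i) -> G (cst 1) ->
  weighted_polar w G h0 -> (forall i, 0 < h0 i) -> (forall i, 0 < u i) ->
  exists p, [/\ weighted_polar w G p, forall i, 0 < p i & exists2 c : R, 0 < c &
    (forall i, c < p i) /\ forall k, weighted_polar w G k -> (forall i, c <= k i) ->
      \sum_i (w i * u i) * ln (k i) <= \sum_i (w i * u i) * ln (p i)].
Proof.
move=> w0 G1 Gh0 h00 u0.
pose F (x : 'rV[R]_n) := \sum_i (w i * u i) * ln (x ord0 i).
pose F0 := \sum_i (w i * u i) * ln (h0 i).
pose U := \sum_i u i.
have wu0 i : 0 < w i * u i by rewrite mulr_gt0.
have mass k : weighted_polar w G k -> \sum_i w i * k i = 1.
  by move=> [_ /(_ _ G1)] <-; apply: eq_bigr => i _; rewrite mulr1.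
have wle1 k i : weighted_polar w G k -> w i * k i <= 1.
  move=> Gk; rewrite -(mass _ Gk).
  apply: (@ler_term_sum _ _ (fun i => w i * k i)) => j.
  by rewrite mulr_ge0 ?(ltW (w0 _))//; case: Gk.
have far k i : weighted_polar w G k -> (forall i, 0 < k i) ->
    F0 <= \sum_i (w i * u i) * ln (k i) -> expR ((F0 - U) / (w i * u i)) <= k i.
  move=> Gk k0 Fk.
  rewrite -[leRHS]lnK ?posrE// ler_expR ler_pdivrMr// lerBlDr (le_trans Fk)//.
  rewrite (bigD1 i)//= mulrC lerD2l /U.
  apply: (@le_trans _ _ (\sum_(j | j != i) u j)).
    apply: ler_sum => j _.
    have lnk : ln (k j) <= k j.
      have := @le_ln1Dx R (k j - 1).
      rewrite (_ : 1 + (k j - 1) = k j) => [H|]; last by ring.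
      by have := k0 j; have := H _; lra.
    apply: (@le_trans _ _ (u j * (w j * k j))); last first.
      by rewrite -[leRHS]mulr1 ler_pM2l// wle1.
    by rewrite mulrA [u j * _]mulrC ler_pM2l.
  by rewrite [leRHS](bigD1 i)//= lerDr ltW.
have [c c0 cP] : exists2 c : R, 0 < c & forall i, c < expR ((F0 - U) / (w i * u i)).
  have [m m0 mP] := @exists_common_lower_bound R n
    (fun i => expR ((F0 - U) / (w i * u i)))
    (fun i => expR_gt0 _).
  by exists (m / 2) => [|i]; [lra|have := mP i; lra].
pose K := [set x : 'rV[R]_n | weighted_polar w G (x ord0) /\ forall i, c <= x ord0 i].
have Kh0 : K (\row_i h0 i).
  have E : (\row_i h0 i) ord0 = h0 by apply/funext => i; rewrite mxE.
  by rewrite /K/= E; split => // i; rewrite (le_trans (ltW (cP i)))// far.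
have Kcl : closed K.
  have -> : K = (\bigcap_i (fun x : 'rV[R]_n => x ord0 i) @^-1` [set y | c <= y]) `&`
     (\bigcap_(g in G) (fun x : 'rV[R]_n => \sum_i w i * (x ord0 i * g i)) @^-1`
       [set y | y = 1]).
    apply/seteqP; split=> x /=; first move=> [[_ Gx] xc].
      by split=> [i _|g Gg]; [exact: xc|exact: Gx].
    move=> [xc Gx]; split; last by move=> i; exact: xc.
    by split => // i; rewrite (le_trans (ltW c0))//; exact: xc.
  apply: closedI; apply: closed_bigI => i _; apply: preimage_closed.
  - by move=> x _; exact: coord_continuous.
  - exact: closed_ge.
  - move=> x _; apply: (@cvg_big _ _ +%R _ _ add_continuous _ (nbhs x)) => j _.
    apply: cvgM; first exact: cvg_cst.
    by apply: cvgM; [exact: coord_continuous|exact: cvg_cst].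
  - exact: closed_eq.
have Kcpt : compact K.
  have box : compact [set x : 'rV[R]_n | forall i, `[c, (w i)^-1]%classic (x ord0 i)].
    apply: (@rV_compact _ _ (fun i => `[c, (w i)^-1]%classic)) => i.
    exact: segment_compact.
  apply: subclosed_compact Kcl box _.
  move=> x [Gx xc] i /=; rewrite in_itv/= xc/=.
  by rewrite -[leRHS]mulr1 ler_pdivlMl// wle1.
have Fcont : {within K, continuous F}.
  apply: continuous_in_subspaceT => x; rewrite inE => -[_ xc].
  apply: (@cvg_big _ _ +%R _ _ add_continuous _ (nbhs x)) => i _.
  apply: cvgM; first exact: cvg_cst.
  apply: continuous_comp; first exact: coord_continuous.
  by apply: continuous_ln; rewrite (lt_le_trans c0).
have [q] := compact_EVT_max (ex_intro _ _ Kh0) Kcpt Fcont.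
rewrite inE => -[Gq qc] qmax.
have q0 i : 0 < q ord0 i by rewrite (lt_le_trans c0).
exists (q ord0); split => //; exists c => //; split.
  move=> i; rewrite (lt_le_trans (cP i))// far//.
  have := qmax _ (mem_set Kh0); rewrite /F; congr (_ <= _).
  by apply: eq_bigr => j _; rewrite mxE.
move=> k Gk kc.
have E : (\row_i k i) ord0 = k by apply/funext => i; rewrite mxE.
have /mem_set/qmax : K (\row_i k i) by rewrite /K/= E.
by rewrite /F E.
Qed.

(** The factors are the maximiser [p] of the weighted logarithm and [u / p].  Near
[p], the line through [p] and any [k] of the polar stays in the truncated polar:
the defining equations are affine and [p] has coordinates strictly above [c]. *)
Lemma density_factorisation w (G : set ('I_n -> R)) h0 u :
  (forall i, 0 < w i) -> G (cst 1) ->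
  weighted_polar w G h0 -> (forall i, 0 < h0 i) -> (forall i, 0 < u i) ->
  \sum_i w i * u i = 1 ->
  exists p, [/\ weighted_polar w G p, forall i, 0 < p i &
    forall k, weighted_polar w G k -> \sum_i w i * (k i * (u i / p i)) = 1].
Proof.
move=> w0 G1 Gh0 h00 u0 u1.
have [p [Gp p0 [c c0 [cp pmax]]]] := maximal_weighted_log_density w0 G1 Gh0 h00 u0.
exists p; split => // k Gk; rewrite -u1.
have [m m0 mP] := @exists_common_lower_bound R n (fun i => p i - c)
  (fun i => etrans (subr_gt0 _ _) (cp i)).
pose D := \sum_i `|k i - p i|.
have D0 : 0 <= D by rewrite sumr_ge0.
have e0 : 0 < m / (D + 1) by rewrite divr_gt0//; lra.
apply: (max_weighted_log_first_order p0 e0) => t te.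
have ct i : c <= p i + t * (k i - p i).
  have : `|t * (k i - p i)| <= m.
    rewrite normrM; have : `|k i - p i| <= D + 1.
      by rewrite (le_trans (@ler_term_sum _ _ (fun i => `|k i - p i|) i _)) ?lerDl.
    move: te; rewrite ltr_pdivlMr; last by lra.
    by have := normr_ge0 t; have := normr_ge0 (k i - p i); nra.
  by rewrite ler_norml => /andP[+ _]; have := mP i; lra.
split; first by move=> i; rewrite (lt_le_trans c0).
apply: pmax => //; split; first by move=> i; rewrite (le_trans (ltW c0)).
move=> g Gg.
transitivity ((1 - t) * \sum_i w i * (p i * g i) + t * \sum_i w i * (k i * g i)).
  rewrite !mulr_sumr -big_split/=; apply: eq_bigr => i _; ring.
by case: Gp => _ ->//; case: Gk => _ ->//; lra.
Qed.

End Factorisation.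

(** * The atoms of a finitely supported probability *)

Section Atoms.
Context (d : measure_display) (T : measurableType d) (R : realType).
Variable P : probability T R.

Definition carried_by n (pt : 'I_n -> T) : Prop :=
  forall A, measurable A -> (forall i, ~ A (pt i)) -> P A = 0%E.

Definition isolates n (pt : 'I_n -> T) (A : 'I_n -> set T) : Prop :=
  forall i, [/\ measurable (A i), P (A i) != 0%E & forall j, A i (pt j) <-> j = i].

Lemma finitely_supported_carried : finitely_supported P ->
  exists n (pt : 'I_n -> T), carried_by pt.
Proof.
move=> [F /finite_seqP[s ->] Fs].
exists (size s), (tnth (in_tuple s)) => A mA Apt; apply: Fs => //.
rewrite -subset0 => x [Ax] /= xs.
have /tnthP[i xE] : x \in in_tuple s by [].
by apply: (Apt i); rewrite -xE.
Qed.

(** In a carrying family of least size no point can be omitted.  The failure of the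
family without [pt i] to carry [P] provides a measurable set of positive measure
that avoids all the other points, and it contains [pt i], as otherwise it would
avoid the whole family. *)
Lemma minimal_carrier_isolated : finitely_supported P ->
  exists n (pt : 'I_n -> T) A, carried_by pt /\ isolates pt A.
Proof.
move=> /finitely_supported_carried[n0 [pt0 c0]].
have ex : exists n, `[< exists pt : 'I_n -> T, carried_by pt >].
  by exists n0; apply/asboolP; exists pt0.
case: (ex_minnP ex) => -[|n] /asboolP[pt cpt] nmin.
  by exists 0%N, pt, (fun=> set0); split => // -[].
exists n.+1, pt.
suff /choice[A AP] : forall i,
    exists A, [/\ measurable A, P A != 0%E & forall j, A (pt j) <-> j = i].
  by exists A.
move=> i.
have : ~ carried_by (pt \o lift i).
  move=> c; have := nmin n; rewrite ltnn => H.
  have /H // : `[< exists pt : 'I_n -> T, carried_by pt >].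
  by apply/asboolP; exists (pt \o lift i).
move=> /existsNP[A /not_implyP[mA /not_implyP[Alift PA]]].
have Ai : A (pt i).
  apply/not_notP => nAi; apply: PA; apply: cpt => // j.
  by case: (unliftP i j) => [k ->|->]; [exact: Alift|].
exists A; split => //; first exact/eqP.
move=> j; split => [|->//].
by case: (unliftP i j) => // k -> /Alift.
Qed.

Context n (pt : 'I_n -> T) (A : 'I_n -> set T).
Hypotheses (cpt : carried_by pt) (iA : isolates pt A).

Definition atom_weight i : R := fine (P (A i)).

Let mA i : measurable (A i). Proof. by have [] := iA i. Qed.

Let indicAE i j : \1_(A i) (pt j) = (j == i)%:R :> R.
Proof.
have [_ _ /(_ j) Aij] := iA i; rewrite indicE.
have -> // : (pt j \in A i) = (j == i).
by apply/idP/eqP; rewrite inE => /Aij.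
Qed.

Lemma atom_weight_gt0 i : 0 < atom_weight i.
Proof.
have [_ PA0 _] := iA i.
by rewrite /atom_weight fine_gt0// lt0e PA0 measure_ge0/= ltey_eq fin_num_measure.
Qed.

(** A measurable null set [N] cannot contain [pt i]: otherwise [A i] minus [N] misses
all the points, hence is null, and so is [A i]. *)
Lemma ae_at_points (Q : T -> Prop) : {ae P, forall x, Q x} -> forall i, Q (pt i).
Proof.
move=> [N [mN PN QN]] i; apply/not_notP => nQ.
have [_ /eqP PA0 Aij] := iA i; apply: PA0.
have Ni : N (pt i) by exact: QN.
rewrite (measureDI P (mA i) mN) [X in (_ + X)%E](_ : _ = 0%E) ?adde0.
  apply: cpt => [|j [/Aij -> //]]; exact: measurableD.
by apply: (@subset_measure0 _ _ _ P _ N) => //; exact: measurableI.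
Qed.

Lemma ae_of_points (Q : set T) :
  measurable Q -> (forall i, Q (pt i)) -> {ae P, forall x, Q x}.
Proof.
move=> mQ Qpt; exists (~` Q); split => //; first exact: measurableC.
by apply: cpt => [|i]; [exact: measurableC|apply].
Qed.

(** [f] agrees at all the points, hence almost everywhere, with the step function
taking the value [f (pt i)] on [A i]; in particular its integral is finite. *)
Lemma integral_at_points (f : T -> R) : measurable_fun setT f ->
  (\int[P]_x (f x)%:E)%E = (\sum_i atom_weight i * f (pt i))%:E.
Proof.
move=> mf.
pose F (x : T) : \bar R := (\sum_i (f (pt i))%:E * (\1_(A i) x)%:E)%E.
have mF : measurable_fun setT F.
  apply: emeasurable_sum => i; apply: emeasurable_funM => //.
  by apply/measurable_EFinP; exact: measurable_indic.
have Fpt i : F (pt i) = (f (pt i))%:E.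
  rewrite /F (bigD1 i)//= indicAE eqxx mule1 big1 ?adde0// => j ji.
  by rewrite indicAE eq_sym (negbTE ji) mule0.
rewrite (@ae_eq_integral _ _ _ P setT F); last 4 first.
- by [].
- exact/measurable_EFinP.
- by [].
- have : {ae P, forall x, (EFin \o f) x = F x}.
    apply: (@ae_of_points [set x | (EFin \o f) x = F x]) => [|i]; last by rewrite /= Fpt.
    by rewrite -[X in measurable X]setTI; apply: measurable_eqe => //; exact/measurable_EFinP.
  by apply: filterS.
rewrite integral_sum//; last first.
  by move=> i; apply: integrableZl => //; exact: integrable_indic.
rewrite -sumEFin; apply: eq_bigr => i _.
rewrite integralZl//; last exact: integrable_indic.
rewrite integral_indic// setIT mulrC EFinM; congr (_ * _)%E.
by rewrite /atom_weight fineK// fin_num_measure.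
Qed.

Lemma L1_measurable (f : L1 P) : measurable_fun setT f.
Proof. exact: (@measurable_funPT _ _ _ _ (repr (f : {mfun_ P, T >-> measurableTypeR R}))). Qed.



Lemma L1_exists_values (a : 'I_n -> R) : exists f : L1 P, forall i, f (pt i) = a i.
Proof.
pose g x := \sum_i a i * \1_(A i) x.
have gpt i : g (pt i) = a i.
  rewrite /g (bigD1 i)//= indicAE eqxx mulr1 big1 ?addr0// => j ji.
  by rewrite indicAE eq_sym (negbTE ji) mulr0.
have mg : measurable_fun setT g.
  by apply: measurable_sum => i; apply: measurable_funM => //; exact: measurable_indic.
pose gm : {mfun T >-> measurableTypeR R} :=
  HB.pack g (@isMeasurableFun.Build _ _ T (measurableTypeR R) g mg).
pose q : {mfun_ P, T >-> measurableTypeR R} := \pi_({mfun_ P, T >-> measurableTypeR R})%qT gm.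
have qg : {ae P, forall x, q x = g x}.
  have /eqmodP/asboolP : (repr q = gm %[mod {mfun_ P, T >-> measurableTypeR R}])%qT.
    by rewrite reprK.
  by apply: filterS => x; exact.
have qfin : finite_norm P 1 q.
  rewrite /finite_norm Lnorm1 (integral_at_points (f := fun x => `|q x|)) ?ltry//.
  by apply: measurableT_comp => //; exact: (@measurable_funPT _ _ _ _ (repr q)).
pose f : L1 P := HB.pack q (@isFinLebesgue.Build _ _ _ P 1%E (lexx 1%E) q qfin).
by exists f => i; rewrite -gpt; exact: (ae_at_points qg).
Qed.

End Atoms.

(** * The two implications in coordinates *)

Section Coordinates.
Context (d : measure_display) (T : measurableType d) (R : realType).
Variable P : probability T R.
Context (n : nat) (pt : 'I_n -> T) (A : 'I_n -> set T).
Hypotheses (cpt : carried_by P pt) (iA : isolates P pt A).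

Let w := atom_weight P A.
Let w0 i : 0 < w i. Proof. exact: atom_weight_gt0 iA i. Qed.

Definition values (f : L1 P) : 'I_n -> R := fun i => f (pt i).

Lemma L1_nneg_values f : L1_nneg P f <-> forall i, 0 <= values f i.
Proof.
split=> [f0 i|f0]; first exact: (ae_at_points cpt iA f0).
apply: (ae_of_points cpt (Q := [set x | 0 <= f x])) => //.
rewrite (_ : [set x | _] = f @^-1` `[0, +oo[%classic); last first.
  by apply/seteqP; split=> x /=; rewrite in_itv/= andbT.
by rewrite -[X in measurable X]setTI; apply: (L1_measurable f) => //; exact: measurable_itv.
Qed.

Lemma pairing_values (f g : L1 P) :
  pairing P f g = (\sum_i w i * (values f i * values g i))%:E.
Proof.
rewrite /pairing (integral_at_points cpt iA (f := fun x => f x * g x))//.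
by apply: measurable_funM; exact: L1_measurable.
Qed.

Lemma Delta_values h : Delta P h <->
  (forall i, 0 <= values h i) /\ \sum_i w i * values h i = 1.
Proof.
rewrite /Delta/= L1_nneg_values /pairing.
under eq_integral do rewrite mulr1.
rewrite (integral_at_points cpt iA (L1_measurable h)).
by split=> -[h0]; [move=> []|move=> h1]; split => //; rewrite -h1.
Qed.

Lemma polar_values (M : set (L1 P)) g :
  polar M g <-> weighted_polar w (values @` M) (values g).
Proof.
rewrite /polar/= /weighted_polar/= L1_nneg_values.
split=> -[g0 gM]; split => //.
  move=> _ [h Mh <-]; have := gM _ Mh; rewrite pairing_values => -[<-].
  by apply: eq_bigr => i _; rewrite [values g i * _]mulrC.
move=> h Mh; rewrite pairing_values -(gM (values h)); last by exists h.
by congr _%:E; apply: eq_bigr => i _; rewrite [values g i * _]mulrC.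
Qed.

Lemma L1_closure_values (M : set (L1 P)) f :
  L1_closure M f <->
  forall e, 0 < e -> exists2 g, M g & wdist w (values f) (values g) < e.
Proof.
have normE (g : L1 P) : ('N[P]_1[(fun x => (f x - g x)%:E)] =
      (wdist w (values f) (values g))%:E)%E.
  rewrite Lnorm1 (integral_at_points cpt iA (f := fun x => `|f x - g x|))//.
  by apply: measurableT_comp => //; apply: measurable_funB; exact: L1_measurable.
by split=> H e /H[g Mg ge]; exists g; rewrite // ?normE ?lte_fin// -lte_fin -normE.
Qed.

Lemma pointwise_products_values (B C : set (L1 P)) u :
  pointwise_products B C u <->
  exists h g, [/\ B h, C g & forall i, values u i = values h i * values g i].
Proof.
split=> -[h [g [Bh Cg ugh]]]; exists h, g; split => //.
  by move=> i; exact: (ae_at_points cpt iA ugh).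
apply: (ae_of_points cpt (Q := [set x | u x = h x * g x])) => //.
rewrite (_ : [set x | _] = [set x | (EFin \o u) x = (EFin \o (fun x => h x * g x)) x]).
  rewrite -[X in measurable X]setTI; apply: measurable_eqe => //; apply/measurable_EFinP.
    exact: L1_measurable.
  by apply: measurable_funM; exact: L1_measurable.
by apply/seteqP; split=> x /=; [move=> ->|move=> []].
Qed.

Lemma values_surjective (a : 'I_n -> R) : exists f, values f = a.
Proof.
have [f fa] := L1_exists_values cpt iA a.
by exists f; apply/funext.
Qed.

Lemma mass_values (M : set (L1 P)) : M `<=` Delta P ->
  forall h, M h -> \sum_i w i * values h i = 1.
Proof. by move=> MD h /MD/Delta_values[]. Qed.

Lemma polar_cst1 (M : set (L1 P)) : M `<=` Delta P ->
  exists2 one, polar M one & values one = cst 1.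
Proof.
move=> MD; have [one oneE] := values_surjective (cst 1); exists one => //.
apply/polar_values; rewrite oneE; split=> [i|_ [h Mh <-]]//=.
by rewrite -[RHS](mass_values MD Mh); apply: eq_bigr => i _; rewrite /= mul1r.
Qed.

(** The bipolar is closed: at each atom, and against each element of the polar, the
values are controlled by the distance, since functions on the atoms are
bounded. *)
Lemma L1_closure_sub_bipolar (M : set (L1 P)) :
  M `<=` Delta P -> L1_closure M `<=` polar (polar M).
Proof.
move=> MD f /L1_closure_values fM; apply/polar_values; split.
  move=> i; rewrite leNgt; apply/negP => fi0.
  have [|h Mh] := fM (w i * - values f i); first by rewrite mulr_gt0// oppr_gt0.
  rewrite ltNge => /negP; apply; apply: le_trans (ler_wdist_coord w0 _ _ i).
  have /Delta_values[h0 _] := MD _ Mh.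
  by rewrite ler_pM2l// distrC ger0_norm; have := h0 i; lra.
move=> _ [g gM <-]; have := gM => /polar_values[g0 _].
apply/eqP; rewrite -subr_eq0 -normr_le0; apply/ler_addgt0Pl => e e0; rewrite addr0.
set C := \sum_i values g i + 1.
have C0 : 0 < C by rewrite ltr_wpDl// sumr_ge0.
have [|h Mh fh] := fM (e / C); first by rewrite divr_gt0.
have <- : \sum_i w i * (values h i * values g i) = 1.
  by have [_ /(_ _ Mh)] := gM; rewrite pairing_values => -[].
apply: le_trans (ler_dist_wdist w0 _ _) _.
apply: le_trans (wdist_mul w0 _ _ g0) _.
by rewrite mulrC -ler_pdivlMr// ltW.
Qed.

(** Mixing [f] in the bipolar with the positive [h0] gives a positive [h] in the
bipolar, close to [f].  As [h] is also in [Delta], it is close to a product, whose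
factor in [M] is close to [h] by [factor_near_density]. *)
Lemma bipolar_sub_L1_closure (M : set (L1 P)) h0 :
  M `<=` Delta P -> M h0 -> (forall i, 0 < values h0 i) ->
  L1_dense_in (pointwise_products M (polar M)) (Delta P) ->
  polar (polar M) `<=` L1_closure M.
Proof.
move=> MD Mh0 h00 dense f ffM; apply/L1_closure_values => e e0.
have massM := mass_values MD.
have [one Mone oneE] := polar_cst1 MD.
have /polar_values[f0 fM] := ffM.
have f1 : \sum_i w i * values f i = 1.
  rewrite -(fM (values one)); last by exists one.
  by apply: eq_bigr => i _; rewrite oneE mulr1.
(* this ratio is below 1, as a mixing weight, and below e / 4 *)
pose t := e / (e + 4).
have t0 : 0 < t by rewrite divr_gt0//; lra.
have t1 : t < 1 by rewrite ltr_pdivrMr; lra.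
have te : 2 * t < e / 2 by rewrite mulrA ltr_pdivrMr; nra.
have [h hE] := values_surjective (fun i => (1 - t) * values f i + t * values h0 i).
have h_gt0 i : 0 < values h i.
  by rewrite hE; have := f0 i; have := h00 i; nra.
have mixE c : \sum_i w i * (values f i * c i) = 1 ->
    \sum_i w i * (values h0 i * c i) = 1 -> \sum_i w i * (values h i * c i) = 1.
  move=> fc hc.
  transitivity ((1 - t) * \sum_i w i * (values f i * c i) +
    t * \sum_i w i * (values h0 i * c i)); last by rewrite fc hc; ring.
  rewrite !mulr_sumr -big_split/=; apply: eq_bigr => i _; rewrite hE; ring.
have h1 : \sum_i w i * values h i = 1.
  rewrite -[RHS](mixE (cst 1)); first by apply: eq_bigr => i _; rewrite mulr1.
    by rewrite -[RHS]f1; apply: eq_bigr => i _; rewrite mulr1.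
  by rewrite -[RHS](massM _ Mh0); apply: eq_bigr => i _; rewrite mulr1.
(* likewise at most 1 and below e / 2 *)
pose s := e / (e + 2).
have s0 : 0 < s by rewrite divr_gt0//; lra.
have s1 : s <= 1 by rewrite ler_pdivrMr; lra.
have se : s < e / 2 by rewrite /s ltr_pdivrMr; nra.
have [|m m0 mP] := @exists_common_lower_bound R n
  (fun i => w i * (s ^+ 2 / 2 * values h i)).
  move=> i; apply: mulr_gt0 => //; apply: mulr_gt0 => //.
  by apply: divr_gt0 => //; exact: exprn_gt0.
have Dh : Delta P h by apply/Delta_values; split => // i; exact: ltW.
have /L1_closure_values/(_ _ m0)[u] := dense _ Dh.
move=> /pointwise_products_values[h' [g [Mh' Mg ugh]]] hu.
exists h' => //.
have /Delta_values[h'0 h'1] := MD _ Mh'.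
have /polar_values[g0 _] := Mg.
have [_ gM] := Mg.
have close : wdist w (values h') (values h) <= s.
  apply: (@factor_near_density _ _ _ w0 (values h) (values h') (values g) s) => //.
    apply: mixE; first by apply: fM; exists g.
    by have := gM _ Mh0; rewrite pairing_values => -[].
  move=> i; rewrite -ugh distrC -(ler_pM2l (w0 i)).
  exact: le_trans (le_trans (ler_wdist_coord w0 _ _ i) (ltW hu)) (mP i).
apply: le_lt_trans (wdist_triangle w0 (values h) _ _) _.
rewrite [X in _ + X]wdist_sym.
have : wdist w (values f) (values h) <= 2 * t.
  by rewrite hE; apply: wdist_mix => //; [move=> i; exact: ltW|exact: massM|exact: ltW].
lra.
Qed.

(** Mixing [u] with [h0] gives a positive density [v], close to [u]; it factors as
[p g] with [p] in the bipolar and [g] in the polar, and [p] is then replaced by a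
nearby element of [M]. *)
Lemma products_dense_of_bipolar_sub_closure (M : set (L1 P)) h0 :
  M `<=` Delta P -> M h0 -> (forall i, 0 < values h0 i) ->
  polar (polar M) `<=` L1_closure M ->
  L1_dense_in (pointwise_products M (polar M)) (Delta P).
Proof.
move=> MD Mh0 h00 closM u /Delta_values[u0 u1]; apply/L1_closure_values => e e0.
have massM := mass_values MD.
(* this ratio is below 1, as a mixing weight, and below e / 4 *)
pose t := e / (e + 4).
have t0 : 0 < t by rewrite divr_gt0//; lra.
have t1 : t < 1 by rewrite ltr_pdivrMr; lra.
have te : 2 * t < e / 2 by rewrite mulrA ltr_pdivrMr; nra.
pose v i := (1 - t) * values u i + t * values h0 i.
have v_gt0 i : 0 < v i by rewrite /v; have := u0 i; have := h00 i; nra.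
have v1 : \sum_i w i * v i = 1.
  transitivity ((1 - t) * \sum_i w i * values u i + t * \sum_i w i * values h0 i).
    by rewrite !mulr_sumr -big_split/=; apply: eq_bigr => i _; rewrite /v; ring.
  by rewrite u1 massM//; ring.
pose G := values @` polar M.
have G1 : G (cst 1) by have [one Mone oneE] := polar_cst1 MD; exists one.
have GM h : M h -> weighted_polar w G (values h).
  move=> Mh; apply/polar_values; apply: L1_closure_sub_bipolar => //.
  apply/L1_closure_values => e' e'0; exists h => //.
  by rewrite /wdist big1// => i _; rewrite subrr normr0 mulr0.
have [p [Gp p0 pfact]] := density_factorisation w0 G1 (GM _ Mh0) h00 v_gt0 v1.
have [g gE] := values_surjective (fun i => v i / p i).
have g0 i : 0 <= values g i by rewrite gE ltW// divr_gt0.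
have Mg : polar M g.
  apply/polar_values; split => // _ [h Mh <-]; rewrite -[RHS](pfact _ (GM _ Mh)).
  by apply: eq_bigr => i _; rewrite gE [_ / _ * _]mulrC.
have [q qE] := values_surjective p.
have /closM/L1_closure_values Mq : polar (polar M) q by apply/polar_values; rewrite qE.
set C := \sum_i values g i + 1.
have C0 : 0 < C by rewrite ltr_wpDl// sumr_ge0.
have [|h Mh qh] := Mq (e / 2 / C); first by rewrite !divr_gt0.
have [z zE] := values_surjective (fun i => values h i * values g i).
exists z; first by apply/pointwise_products_values; exists h, g; split => // i; rewrite zE.
apply: le_lt_trans (wdist_triangle w0 v _ _) _.
have uv : wdist w (values u) v <= 2 * t.
  by apply: wdist_mix => //; [move=> i; exact: ltW|exact: massM|exact: ltW].
have := wdist_mul w0 (values q) (values h) g0.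
rewrite -zE -/C => qhg.
have : C * wdist w (values q) (values h) < e / 2 by rewrite mulrC -ltr_pdivlMr.
have vE : (fun i => values q i * values g i) = v.
  by apply/funext => i; rewrite qE gE; field; rewrite gt_eqF.
rewrite vE in qhg; lra.
Qed.

End Coordinates.

Theorem theorem3p8 (d : measure_display) (T : measurableType d) (R : realType)
    (P : probability T R) (M : set (L1 P)) :
  finitely_supported P ->
  M `<=` Delta P ->
  (exists2 h0 : L1 P, M h0 & {ae P, forall x, 0 < h0 x}) ->
  L1_dense_in (pointwise_products M (polar M)) (Delta P) <->
  L1_closure M = polar (polar M).
Proof.
move=> /minimal_carrier_isolated[n [pt [A [cpt iA]]]] MD [h0 Mh0 h0_gt0].
have {}h0_gt0 := ae_at_points cpt iA h0_gt0.
split=> [dense|closE].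
  apply/seteqP; split; first exact: (L1_closure_sub_bipolar cpt iA MD).
  exact: (bipolar_sub_L1_closure cpt iA MD Mh0 h0_gt0 dense).
apply: (products_dense_of_bipolar_sub_closure cpt iA MD Mh0 h0_gt0).
by rewrite closE.
Qed.
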